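(* There exists a function $f$ such that, for every positive integer $t$, if $M$ is a matroid with the $(t,2t)$-property and $|E(M)| \ge f(t)$, then $E(M)$ has a partition into pairs (2-element sets) such that the union of any $t$ of these pairs is both a circuit and a cocircuit of $M$.
   Context: A matroid $M$ has the $(t,\ell)$-property if every $t$-element subset of $E(M)$ is contained in both an $\ell$-element circuit and an $\ell$-element cocircuit of $M$. *)

(* Defs.v *)
(* A finite matroid is given on the ground set E(M) = [set: T]
   of a finite type T, by its family of independent sets. *)
From mathcomp Require Import all_boot.
Set Implicit Arguments. Unset Strict Implicit. Unset Printing Implicit Defensive.

Section Matroid.
Variable T : finType.

Definition is_matroid (indep : {set T} -> bool) : Prop :=
  [/\ indep set0,
      (forall A B : {set T}, B \subset A -> indep A -> indep B) &
      (forall A B : {set T}, indep A -> indep B -> #|A| < #|B| ->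
         exists2 e, e \in B :\: A & indep (e |: A))].

Definition circuit (indep : {set T} -> bool) (C : {set T}) : bool :=
  ~~ indep C && [forall D : {set T}, (D \proper C) ==> indep D].

Definition is_basis (indep : {set T} -> bool) (B : {set T}) : bool :=
  indep B && [forall X : {set T}, (B \proper X) ==> ~~ indep X].

Definition dual_indep (indep : {set T} -> bool) (X : {set T}) : bool :=
  [exists B : {set T}, is_basis indep B && (X \subset ~: B)].

Definition cocircuit (indep : {set T} -> bool) (C : {set T}) : bool :=
  circuit (dual_indep indep) C.

Definition tl_property (indep : {set T} -> bool) (t l : nat) : Prop :=
  forall X : {set T}, #|X| = t ->
    (exists2 C : {set T}, X \subset C & (#|C| = l /\ circuit indep C)) /\
    (exists2 D : {set T}, X \subset D & (#|D| = l /\ cocircuit indep D)).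

End Matroid.

(* Main.v *)
(* By a nullity count, a matroid of large size whose elements all lie in
   2t-element circuits has a circuit avoiding any prescribed small set U.
   Iterating, we find t-1 disjoint circuits outside U, and a 2t-element
   cocircuit D through some x in U and one element of each of these circuits
   has at least 2(t-1) elements outside U, by orthogonality; hence D meets U in
   at most two elements. Taking for U a union of boundedly many 2t-element
   circuits through x, we see that all 2t-element circuits through x share a
   second element y; the same count shows that y also belongs to all 2t-element
   cocircuits through x. The pairs {x, y} are the required ones. *)
Require Import Defs.
From mathcomp Require Import all_boot.
From mathcomp Require Import zify.

Set Implicit Arguments.
Unset Strict Implicit.
Unset Printing Implicit Defensive.

(* A union of s + 1 circuits of size at most k, each contributing a new element,
   has nullity above s, and so remains dependent after deleting s elements. *)
Definition gap k s := s + k * s.+1.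

(** One half of the property, for an arbitrary family, so that circuits and cocircuits can exchange
    roles. *)
Definition t_covering (T : finType) t (F : {set T} -> bool) :=
  forall X : {set T}, #|X| = t ->
    exists2 Y : {set T}, X \subset Y & (#|Y| = 2 * t /\ F Y).

(** The bound on [U :|: X] is what allows iteration, with [U :|: X] as the next set to avoid. *)
Definition avoiding (T : finType) k (F : {set T} -> bool) :=
  forall U : {set T}, gap k #|U| <= #|T| ->
    exists X : {set T}, [/\ F X, X != set0, [disjoint U & X] &
                            #|U :|: X| <= gap k #|U|].

Lemma exists_set_through (T : finType) (x : T) t : 0 < t <= #|T| ->
  exists2 Z : {set T}, x \in Z & #|Z| = t.
Proof.
elim: t => // -[_ _|t IHt ltT].
  by exists [set x]; rewrite ?set11 ?cards1.
have [Z xZ cardZ] := IHt (ltnW ltT).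
have /set0Pn[y] : ~: Z != set0 by rewrite -card_gt0 cardsCs setCK subn_gt0 cardZ.
rewrite inE => yZ; exists (y |: Z); first by rewrite setU1r.
by rewrite cardsU1 yZ cardZ.
Qed.

(** * Bases, duality, nullity and orthogonality in a matroid *)

Section MatroidFacts.
Variables (T : finType) (indep : {set T} -> bool).
Hypothesis matM : is_matroid indep.
Implicit Types A B C D F G I J X : {set T}.

Lemma indep_sub A B : B \subset A -> indep A -> indep B.
Proof. by case: matM => _ + _; apply. Qed.

Lemma indep_augment A B : indep A -> indep B -> #|A| < #|B| ->
  exists2 e, e \in B :\: A & indep (e |: A).
Proof. by case: matM => _ _; apply. Qed.

Lemma indep_extend I X : indep I -> I \subset X ->
  exists J, [/\ I \subset J, J \subset X, indep J &
                forall K, indep K -> K \subset X -> #|K| <= #|J|].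
Proof.
move=> iI sIX; have [|J maxJ sIJ] := @maxset_exists _
  (fun J : {set T} => indep J && (J \subset X)) I; first by rewrite iI.
have /andP[iJ sJX] := maxsetp maxJ.
exists J; split=> // K iK sKX; rewrite leqNgt; apply/negP => ltJK.
have [e /setDP[eK eJ] ieJ] := indep_augment iJ iK ltJK.
have PeJ : indep (e |: J) && (e |: J \subset X).
  by rewrite ieJ subUset sub1set sJX (subsetP sKX).
by rewrite -(maxsetsup maxJ PeJ (subsetUr _ _)) setU11 in eJ.
Qed.

Lemma basisP B :
  reflect (indep B /\ forall I, indep I -> #|I| <= #|B|) (is_basis indep B).
Proof.
apply: (iffP andP) => [[iB /forallP maxB]|[iB maxB]]; split=> //.
  move=> I iI; rewrite leqNgt; apply/negP => ltBI.
  have [e /setDP[_ eB] ieB] := indep_augment iB iI ltBI.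
  suff ltBeB : B \proper e |: B.
    by have /implyP/(_ ltBeB) := maxB (e |: B); rewrite ieB.
  by rewrite properE subsetUr subUset sub1set (negPf eB).
apply/forallP => X; apply/implyP => /proper_card ltBX.
by apply/negP => /maxB; rewrite leqNgt ltBX.
Qed.

Lemma basis_extend I B : indep I -> is_basis indep B ->
  exists J, [/\ I \subset J, J \subset I :|: B & is_basis indep J].
Proof.
move=> iI /basisP[iB maxB].
have [J [sIJ sJX iJ maxJ]] := indep_extend iI (subsetUl I B).
exists J; split=> //; apply/basisP; split=> // K iK.
exact: leq_trans (maxB K iK) (maxJ B iB (subsetUr _ _)).
Qed.

Lemma exists_basis : exists B, is_basis indep B.
Proof.
case: (matM) => i0 _ _.
have [J [_ _ iJ maxJ]] := indep_extend i0 (subsetT set0).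
by exists J; apply/basisP; split=> // K iK; apply: maxJ.
Qed.

Lemma card_basis B B' : is_basis indep B -> is_basis indep B' -> #|B| = #|B'|.
Proof.
move=> /basisP[iB mB] /basisP[iB' mB'].
by apply/eqP; rewrite eqn_leq mB // mB'.
Qed.

Lemma dual_indepP X :
  reflect (exists2 B, is_basis indep B & [disjoint X & B]) (dual_indep indep X).
Proof.
apply: (iffP existsP) => [[B /andP[bB sXB]]|[B bB dXB]]; exists B => //.
  by rewrite disjoints_subset.
by rewrite bB -disjoints_subset.
Qed.

Lemma dual_is_matroid : is_matroid (dual_indep indep).
Proof.
split.
- have [B bB] := exists_basis.
  by apply/dual_indepP; exists B; rewrite // -setI_eq0 set0I.
- move=> A B sBA /dual_indepP[B' bB' dA]; apply/dual_indepP; exists B' => //.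
  exact: disjointWl dA.
move=> A X /dual_indepP[BA bA dA] /dual_indepP[BX bX dX] ltAX.
have iXA : indep (BX :\: A).
  by have /basisP[iBX _] := bX; apply: indep_sub iBX; apply: subsetDl.
have [J [sXJ sJ bJ]] := basis_extend iXA bA.
have dAJ : [disjoint A & J].
  apply: disjointWr sJ _; rewrite -setI_eq0 setIUr setU_eq0 !setI_eq0 dA andbT.
  by rewrite disjoint_sym disjoints_subset setDE subsetIr.
(* If [J] contained [X :\: A] as well as the disjoint [BX :\: A], then
   [#|X :\: A| <= #|A :&: BX| <= #|A :\: X|], against [#|A| < #|X|]. Otherwise [J] itself witnesses
   the exchange. *)
have [sXAJ|] := boolP (X :\: A \subset J).
  have dXX : [disjoint X :\: A & BX :\: A].
    by apply: disjointW dX; apply: subsetDl.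
  have := subset_leq_card (introT subUsetP (conj sXAJ sXJ)).
  rewrite cardsU (eqP (_ : (X :\: A) :&: (BX :\: A) == set0)) ?setI_eq0 //.
  rewrite cards0 subn0 (card_basis bJ bX) => le1.
  have le2 : #|A :&: BX| <= #|A :\: X|.
    apply: subset_leq_card; apply/subsetP => e /setIP[eA eB].
    by rewrite inE eA andbT; apply: contraL eB => /(disjointFr dX) ->.
  move: ltAX; rewrite -(cardsID X A) -(cardsID A X) (setIC X) ltn_add2l ltnNge.
  move: le1; rewrite -(cardsID A BX) leq_add2r (setIC BX).
  by move/leq_trans/(_ le2) ->.
case/subsetPn=> e eXA eJ; exists e => //; apply/dual_indepP; exists J => //.
by rewrite disjoints_subset subUset sub1set inE eJ -disjoints_subset.
Qed.

Lemma circuit_dep C : circuit indep C -> ~~ indep C.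
Proof. by case/andP. Qed.

Lemma circuit_rem C e : circuit indep C -> e \in C -> indep (C :\ e).
Proof. by case/andP=> _ /forallP/(_ (C :\ e))/implyP + /properD1; apply. Qed.

Lemma dep_circuit X : ~~ indep X -> exists2 C, circuit indep C & C \subset X.
Proof.
move=> dX; have [C minC sCX] := @minset_exists _ (fun C => ~~ indep C) X dX.
exists C => //; rewrite /circuit (minsetp minC).
apply/forallP => D; apply/implyP => /andP[sDC nsCD].
apply: contraNT nsCD => dD.
by rewrite (minsetinf minC dD sDC).
Qed.

Lemma circuit_neq0 C : circuit indep C -> C != set0.
Proof.
by move/circuit_dep; apply: contraNneq => ->; case: matM.
Qed.

(* The bound #|I| + m <= #|G| for all independent I in G says that G has nullity
   at least m. *)
Lemma nullity_gain m G C x : circuit indep C -> x \in C -> x \notin G ->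
  (forall I, indep I -> I \subset G -> #|I| + m <= #|G|) ->
  forall I, indep I -> I \subset G :|: C -> #|I| + m.+1 <= #|G :|: C|.
Proof.
move=> cC xC xG nG I iI sI.
(* A largest independent [J] containing [C :\ x] must omit [x]. It thus falls short by [m] inside
   [G] and by at least one more outside. *)
have [|J [sCJ sJ iJ maxJ]] :=
  indep_extend (X := G :|: C) (circuit_rem cC xC).
  by apply: subset_trans (subsetDl _ _) (subsetUr _ _).
have xJ : x \notin J.
  apply/negP => xJ; case/negP: (circuit_dep cC); apply: indep_sub iJ.
  by rewrite -(setD1K xC) subUset sub1set xJ.
have le1 := maxJ I iI sI.
have le2 : #|J :&: G| + m <= #|G|.
  by apply: nG (subsetIr _ _); apply: indep_sub iJ; apply: subsetIl.
have le3 : #|J :\: G| < #|(G :|: C) :\: G|.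
  apply: proper_card; apply/properP; split; first exact: setSD.
  by exists x; rewrite !inE ?xG ?xC ?orbT // (negPf xJ) andbF.
have := cardsID G J; have := cardsID G (G :|: C).
rewrite (setIidPr (subsetUl _ _)); lia.
Qed.

Lemma circuits_avoiding k : 0 < k ->
  (forall x, exists C, [/\ circuit indep C, x \in C & #|C| <= k]) ->
  avoiding k (circuit indep).
Proof.
move=> k_gt0 covC F leT.
suff [G [sFG leG nG]] : exists G, [/\ F \subset G, #|G| <= gap k #|F| &
    forall I, indep I -> I \subset G -> #|I| + #|F|.+1 <= #|G|].
  have dGF : ~~ indep (G :\: F).
    apply/negP => iGF; have := nG _ iGF (subsetDl _ _).
    by rewrite cardsD (setIidPr sFG); have := subset_leq_card sFG; lia.
  have [C cC sC] := dep_circuit dGF; exists C; split=> //.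
  - exact: circuit_neq0 cC.
  - rewrite disjoint_sym disjoints_subset.
    by apply: subset_trans sC _; rewrite setDE subsetIr.
  - apply: leq_trans leG; apply: subset_leq_card; rewrite subUset sFG.
    exact: subset_trans sC (subsetDl _ _).
suff: forall m, m <= #|F|.+1 -> exists G, [/\ F \subset G, #|G| <= #|F| + k * m &
    forall I, indep I -> I \subset G -> #|I| + m <= #|G|].
  exact.
elim=> [|m IHm] lem.
  exists F; split=> // [|I _ sI]; first by rewrite muln0 addn0.
  by rewrite addn0 subset_leq_card.
have [G [sFG leG nG]] := IHm (ltnW lem).
(* At most [#|F|] circuits have been added so far, so [0 < k] makes the bound strict. *)
have ltG : #|G| < #|T| by move: leT; rewrite /gap; nia.
have /set0Pn[x] : ~: G != set0.
  by rewrite -card_gt0 cardsCs setCK subn_gt0.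
rewrite inE => xG; have [C [cC xC leC]] := covC x.
exists (G :|: C); split.
- exact: subset_trans sFG (subsetUl _ _).
- by rewrite cardsU; lia.
exact: nullity_gain xG nG.
Qed.

(** If they met in [e] alone, a maximal independent set off [D] containing [C :\ e] would be a
    basis: augmenting it from a basis that avoids [D :\ e] is impossible. Then [D] would be
    independent in the dual. *)
Lemma circuit_cocircuit_orth C D :
  circuit indep C -> cocircuit indep D -> #|C :&: D| != 1.
Proof.
move=> cC cD; apply/cards1P => -[e eCD].
have /setIP[eC eD] : e \in C :&: D by rewrite eCD set11.
have /andP[nD /forallP/(_ (D :\ e))/implyP/(_ (properD1 eD))] := cD.
case/dual_indepP=> B bB dB.
have sCD : C :\ e \subset ~: D.
  apply/subsetP => z /setD1P[nze zC]; rewrite inE; apply: contraNN nze => zD.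
  by rewrite -in_set1 -eCD inE zC.
have [I [sCI sID iI maxI]] := indep_extend (circuit_rem cC eC) sCD.
case/negP: nD; apply/dual_indepP; exists I; last first.
  by rewrite disjoint_sym disjoints_subset.
have /basisP[iB maxB] := bB.
apply/basisP; split=> // K /maxB leK; apply: leq_trans leK _.
rewrite leqNgt; apply/negP => ltIB.
have [f /setDP[fB fI] ifI] := indep_augment iI iB ltIB.
have [ef|nef] := eqVneq f e.
  case/negP: (circuit_dep cC); apply: indep_sub ifI.
  by rewrite -(setD1K eC) ef setUS.
have := maxI _ ifI; rewrite subUset sub1set sID inE.
rewrite cardsU1 fI ltnn andbT => nfD.
have fD : f \in D :\ e by rewrite !inE nef; case: (f \in D) nfD => // /(_ isT).
by rewrite (disjointFr dB fD) in fB.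
Qed.

End MatroidFacts.

(** * Small intersections and common partners *)

Lemma iter_gap_homo k m : {homo iter m (gap k) : i j / i <= j}.
Proof.
elim: m => //= m IHm i j /IHm le_ij.
by rewrite /gap leq_add // leq_mul2l ltnS le_ij orbT.
Qed.

Lemma leq_iter_gap k m s : s <= iter m (gap k) s.
Proof. by elim: m => //= m IHm; apply: leq_trans IHm (leq_addr _ _). Qed.

(* (C, D) stands for both (circuits, cocircuits) and (cocircuits, circuits). *)
Section OrthogonalFamilies.
Variables (T : finType) (C D : {set T} -> bool) (k : nat).
Implicit Types F U X Y Z : {set T}.

Hypothesis orth : forall X Y, C X -> D Y -> #|X :&: Y| != 1.
Hypothesis avoidC : avoiding k C.

Lemma orth_ge2 X Y x : C X -> D Y -> x \in X -> x \in Y -> 1 < #|X :&: Y|.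
Proof.
move=> cX dY xX xY; rewrite ltn_neqAle eq_sym orth //=.
by apply/card_gt0P; exists x; rewrite inE xX.
Qed.

(** One element is taken from each of [m] disjoint [C]-sets off [U]; by orthogonality [Y] has a
    second element in each of them. *)
Lemma transversal_outside m U : iter m (gap k) #|U| <= #|T| ->
  exists X, [/\ #|X| = m, [disjoint U & X] &
    forall Y, D Y -> X \subset Y -> 2 * m <= #|Y :\: U|].
Proof.
elim: m U => [|m IHm] U leT.
  by exists set0; rewrite cards0 disjoint_sym -setI_eq0 set0I muln0.
(* The innermost [gap] pays for enlarging [U] to [U :|: A]. *)
rewrite iterSr in leT.
have [A [cA /set0Pn[x xA] dUA leUA]] := avoidC (leq_trans (leq_iter_gap k m _) leT).
have [X [cardX dX outX]] := IHm _ (leq_trans (iter_gap_homo _ _ leUA) leT).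
have xU : x \notin U by rewrite (disjointFl dUA xA).
have xX : x \notin X by rewrite (disjointFr dX) // inE xA orbT.
exists (x |: X); split.
- by rewrite cardsU1 xX cardX.
- rewrite disjoint_sym disjoints_subset subUset sub1set inE xU.
  rewrite -disjoints_subset disjoint_sym.
  by apply: disjointWl dX; apply: subsetUl.
move=> Y dY; rewrite subUset sub1set => /andP[xY /(outX Y dY) leY].
have le2 := orth_ge2 cA dY xA xY.
have := cardsID (U :|: A) (Y :\: U); rewrite setDDl setUA setUid.
suff : #|A :&: Y| <= #|(Y :\: U) :&: (U :|: A)| by lia.
apply: subset_leq_card; apply/subsetP => z /setIP[zA zY].
by rewrite !inE zA zY orbT (disjointFl dUA zA).
Qed.

Variable t : nat.
Hypothesis t_gt0 : 0 < t.
Hypotheses (coverD : t_covering t D) (coverC : t_covering t C).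

(** With [t.-1] transversal elements added to [x], at least [2 * t.-1] of the [2 * t] elements of
    [Y] lie off [U]. *)
Lemma tset_through U x : x \in U -> iter t.-1 (gap k) #|U| <= #|T| ->
  exists Z, [/\ x \in Z, #|Z| = t &
    forall Y, D Y -> Z \subset Y -> #|Y| = 2 * t -> #|Y :&: U| <= 2].
Proof.
move=> xU /transversal_outside[X [cardX dX outX]].
exists (x |: X); split; first exact: setU11.
  by rewrite cardsU1 cardX (disjointFr dX xU); lia.
move=> Y dY; rewrite subUset => /andP[_ /(outX Y dY) leY] cardY.
by have := cardsID U Y; lia.
Qed.

Lemma D_through U x : x \in U -> iter t.-1 (gap k) #|U| <= #|T| ->
  exists Y, [/\ D Y, #|Y| = 2 * t, x \in Y & #|Y :&: U| <= 2].
Proof.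
move=> xU /(tset_through xU)[Z [xZ cardZ smallZ]].
have [Y sZY [cardY dY]] := coverD cardZ.
by exists Y; split=> //; [apply: (subsetP sZY) | apply: smallZ].
Qed.

Hypothesis largeT : iter t.-1 (gap k) (2 * t + 2 * t * (2 * t)) <= #|T|.

Lemma large_enough U :
  #|U| <= 2 * t + 2 * t * (2 * t) -> iter t.-1 (gap k) #|U| <= #|T|.
Proof. by move=> leU; apply: leq_trans largeT; apply: iter_gap_homo. Qed.

Lemma C_through x : exists X, [/\ C X, #|X| = 2 * t & x \in X].
Proof.
have [|Z [xZ cardZ _]] := tset_through (set11 x).
  by apply: large_enough; rewrite cards1; lia.
have [X sZX [cardX cX]] := coverC cardZ.
by exists X; split=> //; apply: (subsetP sZX).
Qed.

(* If every y in X1 other than x were missed by some X = W y through x, then a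
   D-set meeting the union U of X1 and all the W y in just {x, y} would meet
   W y in x only, against orthogonality. *)
Lemma common_element x : exists2 y, y != x &
  forall X, C X -> #|X| = 2 * t -> x \in X -> y \in X.
Proof.
have [X1 [cX1 cardX1 xX1]] := C_through x.
pose bad y X := [&& C X, #|X| == 2 * t, x \in X & y \notin X].
(* The default [set0] adds nothing to [U]; it occurs only for those [y] that no such set through [x]
   misses. *)
pose W y := odflt set0 [pick X | bad y X].
pose U := X1 :|: \bigcup_(y in X1) W y.
have leU : #|U| <= 2 * t + 2 * t * (2 * t).
  rewrite (leq_trans (leq_card_setU _ _)) // cardX1 leq_add2l.
  rewrite -{1}cardX1 -sum_nat_const.
  apply: (big_ind2 (fun (A : {set T}) n => #|A| <= n)) => [|A i B j leA leB|y _].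
  - by rewrite cards0.
  - exact: leq_trans (leq_card_setU _ _) (leq_add leA leB).
  rewrite /W; case: pickP => [X|_] /=; last by rewrite cards0.
  by case/and4P=> _ /eqP->.
have xU : x \in U by rewrite inE xX1.
have [Y [dY cardY xY leYU]] := D_through xU (large_enough leU).
have /card_gt1P[a [b [/setIP[aX1 aY] /setIP[bX1 bY] ab]]] := orth_ge2 cX1 dY xX1 xY.
have [y [yx yX1 yY]] : exists y, [/\ y != x, y \in X1 & y \in Y].
  have [ax|ax] := eqVneq a x; last by exists a.
  by exists b; rewrite -ax eq_sym.
exists y => // X cX cardX xX; apply: contraT => yX.
have : bad y (W y).
  rewrite /W; case: pickP => //= /(_ X).
  by rewrite /bad cX cardX eqxx xX yX.
case/and4P=> cW _ xW yW.
have sWU : W y \subset U.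
  by apply: subset_trans (subsetUr _ _); apply: bigcup_sup yX1.
have := orth_ge2 cW dY xW xY.
have : y |: (W y :&: Y) \subset Y :&: U.
  rewrite subUset sub1set inE yY inE yX1 /= setIC.
  exact: setIS.
move/subset_leq_card/leq_trans/(_ leYU).
by rewrite cardsU1 inE (negPf yW) /= add1n ltnS leqNgt => /negbTE ->.
Qed.

(** Some [D]-set through [x] meets [y |: X] in at most two elements, already [x] and [y]. If [y]
    were not in [X], it would meet [X] in [x] alone. *)
Lemma C_contains_D_partner x y : y != x ->
  (forall Y, D Y -> #|Y| = 2 * t -> x \in Y -> y \in Y) ->
  forall X, C X -> #|X| = 2 * t -> x \in X -> y \in X.
Proof.
move=> yx yD X cX cardX xX; apply: contraT => yX.
have xU : x \in y |: X by rewrite inE xX orbT.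
have [|Y [dY cardY xY leY]] := D_through xU.
  by apply: large_enough; rewrite cardsU1 yX cardX addnC leq_add2l !muln_gt0 t_gt0.
have := orth_ge2 cX dY xX xY.
have : y |: (X :&: Y) \subset Y :&: (y |: X).
  by rewrite subUset sub1set !inE eqxx yD //= setIC setIS // subsetUr.
move/subset_leq_card/leq_trans/(_ leY).
by rewrite cardsU1 inE (negPf yX) /= add1n ltnS leqNgt => /negbTE ->.
Qed.

(** Some [C]-set and [D]-set through [x] share at most two elements, but both contain [x], [p x] and
    [p (p x)]. *)
Lemma partner_involutive (p : T -> T) : (forall x, p x != x) ->
  (forall x X, C X -> #|X| = 2 * t -> x \in X -> p x \in X) ->
  (forall x Y, D Y -> #|Y| = 2 * t -> x \in Y -> p x \in Y) ->
  involutive p.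
Proof.
move=> p_neq pC pD x; have [X [cX cardX xX]] := C_through x.
have [|Y [dY cardY xY leY]] := D_through xX.
  by apply: large_enough; rewrite cardX leq_addr.
apply: contraTeq leY => ppx; rewrite -ltnNge.
have pXY z : z \in Y :&: X -> p z \in Y :&: X.
  by case/setIP=> zY zX; rewrite inE (pD z) // (pC z).
have xXY : x \in Y :&: X by rewrite inE xY.
apply/card_gt2P; exists x, (p x), (p (p x)).
split; split=> //; [exact: pXY | exact/pXY/pXY | |].
  by rewrite eq_sym.
by rewrite eq_sym.
Qed.

End OrthogonalFamilies.

(** * The partition into orbits of a fixed-point-free involution *)

Section PairsOfInvolution.
Variables (T : finType) (p : T -> T).
Hypotheses (p_neq : forall x, p x != x) (pK : involutive p).

Definition pairs : {set {set T}} := [set [set x; p x] | x : T].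

Lemma pairsE A x : A \in pairs -> x \in A -> A = [set x; p x].
Proof. by case/imsetP=> z _ -> /set2P[->|->] //; rewrite pK setUC. Qed.

Lemma card_pairs A : A \in pairs -> #|A| = 2.
Proof. by case/imsetP=> z _ ->; rewrite cards2 eq_sym p_neq. Qed.

Lemma pairs_partition : partition pairs [set: T].
Proof.
apply/and3P; split.
- rewrite eqEsubset subsetT; apply/subsetP => x _; apply/bigcupP.
  by exists [set x; p x]; [apply: imset_f | rewrite set21].
- apply/trivIsetP => A B pA pB; apply: contraNT => /pred0Pn[x /andP[xA xB]].
  by rewrite (pairsE pA xA) (pairsE pB xB).
by apply/negP => /card_pairs; rewrite cards0.
Qed.

(** A transversal of [S] lies in a [2 * t]-element [F]-set; closure under [p] puts all of [cover S]
    in it, and the sizes agree. *)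
Lemma cover_pairs t (F : {set T} -> bool) (S : {set {set T}}) :
  t_covering t F ->
  (forall x (Y : {set T}), F Y -> #|Y| = 2 * t -> x \in Y -> p x \in Y) ->
  S \subset pairs -> #|S| = t -> F (cover S).
Proof.
move=> coverF pF sS cardS.
have /and3P[_ trivP P0] := pairs_partition.
have partS : partition S (cover S).
  by rewrite /partition eqxx (trivIsetS sS trivP) (contra (subsetP sS _) P0).
have trX := transversalP partS.
have [Y sXY [cardY fY]] := coverF _ (etrans (card_transversal trX) cardS).
suff sSY : cover S \subset Y.
  suff /eqP -> : cover S == Y by [].
  rewrite eqEcard sSY cardY (card_uniform_partition (n := 2) _ partS).
    by rewrite cardS mulnC leqnn.
  by move=> A /(subsetP sS)/card_pairs.
apply/bigcupsP => A AS; have /and3P[_ _ /forall_inP/(_ A AS)] := trX.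
case/cards1P=> w /setP/(_ w); rewrite !inE eqxx => /andP[wX wA].
have wY := subsetP sXY w wX.
rewrite (pairsE (subsetP sS A AS) wA) subUset !sub1set wY.
exact: pF.
Qed.

End PairsOfInvolution.

Theorem theorem1p1 :
  exists f : nat -> nat,
    forall t : nat, 0 < t ->
    forall (T : finType) (indep : {set T} -> bool),
      is_matroid indep ->
      tl_property indep t (2 * t) ->
      f t <= #|T| ->
      exists P : {set {set T}},
        [/\ partition P [set: T],
            (forall X : {set T}, X \in P -> #|X| = 2) &
            (forall S : {set {set T}}, S \subset P -> #|S| = t ->
               circuit indep (cover S) && cocircuit indep (cover S))].
Proof.
(* The start value bounds the union of one circuit and [2 * t] others; each of the [t.-1] iterations
   provides one more disjoint circuit. *)
exists (fun t => iter t.-1 (gap (2 * t)) (2 * t + 2 * t * (2 * t))).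
move=> t t_gt0 T indep matM tlM largeT.
have leT : t <= #|T|.
  by apply: leq_trans largeT; apply: leq_trans (leq_iter_gap _ _ _); lia.
have covC : t_covering t (circuit indep) by move=> X /tlM[].
have covD : t_covering t (cocircuit indep) by move=> X /tlM[].
(* Stated for any matroid, to be applied to the dual too, whose circuits are the cocircuits. *)
have avoid (ind : {set T} -> bool) : is_matroid ind ->
    t_covering t (circuit ind) -> avoiding (2 * t) (circuit ind).
  move=> matI covI; apply: circuits_avoiding => [//||x]; first by rewrite muln_gt0.
  have [|Z xZ cardZ] := @exists_set_through T x t; first exact/andP.
  have [Y sZY [cardY cY]] := covI Z cardZ.
  by exists Y; split; rewrite ?cardY // (subsetP sZY).
have avC := avoid _ matM covC.
have avD := avoid _ (dual_is_matroid matM) covD.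
have orthCD (X Y : {set T}) :
    circuit indep X -> cocircuit indep Y -> #|X :&: Y| != 1.
  exact: circuit_cocircuit_orth.
have orthDC (X Y : {set T}) :
    cocircuit indep X -> circuit indep Y -> #|X :&: Y| != 1.
  by move=> cX cY; rewrite setIC orthCD.
(* Partners are chosen on the cocircuit side, with the roles exchanged, and then transferred to
   circuits. *)
have [p p_neq pD] := fin_all_exists2 (common_element orthDC avD t_gt0 covC covD largeT).
have pC x := C_contains_D_partner orthCD avC t_gt0 covD largeT (p_neq x) (pD x).
have pK := partner_involutive orthCD avC t_gt0 covD covC largeT p_neq pC pD.
exists (pairs p); split; first exact: pairs_partition.
  exact: card_pairs.
move=> S sS cardS; apply/andP; split.
  exact: (cover_pairs p_neq pK covC pC).
exact: (cover_pairs p_neq pK covD pD).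
Qed.
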